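(* Let $p=yu+z^2$, $v=xz+yp$, $w=x^2u-2xzp-yp^2$ in $\mathbb{C}[x][y,z,u]=\mathbb{C}[x]^{[3]}$, and let $f=y+xQ$ with $Q \in \mathbb{C}[x][v,w]$ (a Vénéreau-type polynomial). Then $f$ is a $\mathbb{C}[x]$-hyperplane of $\mathbb{C}[x]^{[3]}$; that is, $\mathbb{C}[x]^{[3]}/(f) \cong \mathbb{C}[x]^{[2]}$ as $\mathbb{C}[x]$-algebras.
   Context: For a commutative ring $A$ with one, $A^{[n]}$ denotes the polynomial ring in $n$ variables over $A$. *)

(* Defs.v *)
From HB Require Import structures.
From mathcomp Require Import all_boot all_order all_algebra.
From mathcomp Require Import boolp reals complex.
From mathcomp Require Import mpoly.

Set Implicit Arguments.
Unset Strict Implicit.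
Unset Printing Implicit Defensive.

Import GRing.Theory.
Local Open Scope ring_scope.
Local Open Scope quotient_scope.

(* [principal f] is the ideal (f); membership is decided classically. *)
Section PrincipalIdeal.
Variables (B : comNzRingType) (f : B).

Definition principal : {pred B} := fun g => `[< exists h : B, g = h * f >].

Lemma principalP g : reflect (exists h : B, g = h * f) (g \in principal).
Proof. exact: asboolP. Qed.

Fact principal_zmod_closed : zmod_closed principal.
Proof.
split=> [|x y /principalP[h ->] /principalP[k ->]]; apply/principalP.
  by exists 0; rewrite mul0r.
by exists (h - k); rewrite mulrBl.
Qed.

HB.instance Definition _ :=
  GRing.isZmodClosed.Build B principal principal_zmod_closed.

Lemma principalM a u : u \in principal -> a * u \in principal.
Proof. by move=> /principalP[h ->]; apply/principalP; exists (a * h); rewrite mulrA. Qed.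

End PrincipalIdeal.

(* The library's {ideal_quot I} gets a ring
   structure only for proper ideals; here (f) is arbitrary, so B / (f) may be
   the zero ring.  The additive group is the library's quotient, to which the
   ring and A-module structures are added. *)
Section PrincipalQuotient.
Variables (A : comNzRingType) (B : comAlgType A) (f : B).

Definition pquot : Type := Quotient.quot (principal f).

HB.instance Definition _ := GRing.Zmodule.on pquot.

Definition pquot_pi (x : B) : pquot := \pi_(Quotient.quot (principal f)) x.

Definition pquot_one : pquot := pquot_pi 1.
Definition pquot_mul (x y : pquot) : pquot := pquot_pi (repr x * repr y).
Definition pquot_scale (a : A) (x : pquot) : pquot := pquot_pi (a *: repr x).

Lemma pquot_piK (x : pquot) : pquot_pi (repr x) = x.
Proof. exact: reprK. Qed.

Lemma pquot_piP (x y : B) :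
  pquot_pi x = pquot_pi y <-> x - y \in principal f.
Proof. by rewrite Quotient.idealrBE; split=> [/eqP|/eqP]. Qed.

Lemma pquot_piD x y : pquot_pi (x + y) = pquot_pi x + pquot_pi y.
Proof. exact: (raddfD (\pi_(Quotient.quot (principal f)))). Qed.

Lemma repr_pquot_pi x : repr (pquot_pi x) - x \in principal f.
Proof. by apply/pquot_piP; rewrite pquot_piK. Qed.

Lemma pquot_piM x y :
  pquot_pi (x * y) = pquot_mul (pquot_pi x) (pquot_pi y).
Proof.
apply/esym/pquot_piP; set x' := repr _; set y' := repr _.
have -> : x' * y' - x * y = x' * (y' - y) + y * (x' - x).
  by rewrite !mulrBr ![y * _]mulrC subrKA.
by rewrite rpredD ?principalM // repr_pquot_pi.
Qed.

Lemma pquot_piZ a x : pquot_pi (a *: x) = pquot_scale a (pquot_pi x).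
Proof.
apply/esym/pquot_piP; rewrite -scalerBr -mulr_algl.
by rewrite principalM // repr_pquot_pi.
Qed.

Fact pquot_mulA : associative pquot_mul.
Proof.
move=> x y z; rewrite -[x]pquot_piK -[y]pquot_piK -[z]pquot_piK.
by rewrite -!pquot_piM mulrA.
Qed.

Fact pquot_mulC : commutative pquot_mul.
Proof. by move=> x y; rewrite /pquot_mul mulrC. Qed.

Fact pquot_mul1 : left_id pquot_one pquot_mul.
Proof. by move=> x; rewrite -[x]pquot_piK -pquot_piM mul1r. Qed.

Fact pquot_mulDl : left_distributive pquot_mul +%R.
Proof.
move=> x y z; rewrite -[x]pquot_piK -[y]pquot_piK -[z]pquot_piK.
by rewrite -pquot_piD -!pquot_piM -pquot_piD mulrDl.
Qed.

HB.instance Definition _ := GRing.Zmodule_isComPzRing.Build pquot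
  pquot_mulA pquot_mulC pquot_mul1 pquot_mulDl.

Fact pquot_scaleA a b x :
  pquot_scale a (pquot_scale b x) = pquot_scale (a * b) x.
Proof. by rewrite -[x]pquot_piK -!pquot_piZ scalerA. Qed.

Fact pquot_scale1 : left_id 1 pquot_scale.
Proof. by move=> x; rewrite -[x]pquot_piK -pquot_piZ scale1r. Qed.

Fact pquot_scaleDr : right_distributive pquot_scale +%R.
Proof.
move=> a x y; rewrite -[x]pquot_piK -[y]pquot_piK.
by rewrite -pquot_piD -!pquot_piZ -pquot_piD scalerDr.
Qed.

Fact pquot_scaleDl x : {morph pquot_scale^~ x : a b / a + b}.
Proof.
move=> a b; rewrite -[x]pquot_piK -!pquot_piZ.
by rewrite -pquot_piD scalerDl.
Qed.

HB.instance Definition _ := GRing.Zmodule_isLmodule.Build A pquot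
  pquot_scaleA pquot_scale1 pquot_scaleDr pquot_scaleDl.

(* The library's algebra structures require 1 != 0, so the algebra axiom is
   recorded as a lemma; right compatibility follows by commutativity. *)
Lemma pquot_scaleAl (a : A) (x y : pquot) : a *: (x * y) = (a *: x) * y.
Proof.
rewrite -[x]pquot_piK -[y]pquot_piK.
by rewrite /GRing.scale /= /GRing.mul /= -pquot_piM -!pquot_piZ -pquot_piM scalerAl.
Qed.

End PrincipalQuotient.

(* f is an A-hyperplane of A^[n+1] : A^[n+1] / (f) and A^[n] are isomorphic
   as A-algebras. *)
Definition hyperplane (A : comNzRingType) (n : nat) (f : {mpoly A[n.+1]}) : Prop :=
  exists phi : pquot f -> {mpoly A[n]},
    [/\ linear phi, monoid_morphism phi & bijective phi].

(* Q belongs to the A-subalgebra A[s_0, ..., s_(k-1)] of A^[n]. *)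
Definition in_subalg (A : comNzRingType) (n k : nat)
    (s : k.-tuple {mpoly A[n]}) (Q : {mpoly A[n]}) : Prop :=
  exists q : {mpoly A[k]}, Q = q \mPo s.

(* In k[x]^[3] the indeterminates y, z, u have indices 0, 1, 2, and x is the
   indeterminate of the coefficient ring k[x] = {poly k}. *)
Section Venereau.
Variable k : comNzRingType.
Local Notation P := {mpoly {poly k}[3]}.

Definition ven_x : P := ('X : {poly k})%:MP.
Definition ven_y : P := 'X_(@Ordinal 3 0 isT).
Definition ven_z : P := 'X_(@Ordinal 3 1 isT).
Definition ven_u : P := 'X_(@Ordinal 3 2 isT).

Definition ven_p : P := ven_y * ven_u + ven_z ^+ 2.
Definition ven_v : P := ven_x * ven_z + ven_y * ven_p.
Definition ven_w : P :=
  ven_x ^+ 2 * ven_u - 2%:R * ven_x * ven_z * ven_p - ven_y * ven_p ^+ 2.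

End Venereau.

(* Main.v *)
Require Import Defs.
From HB Require Import structures.
From mathcomp Require Import all_boot all_order all_algebra.
From mathcomp Require Import boolp reals complex.
From mathcomp Require Import mpoly.
From mathcomp Require Import ring.

Set Implicit Arguments.
Unset Strict Implicit.
Unset Printing Implicit Defensive.

Import GRing.Theory.
Local Open Scope ring_scope.

(* Modulo f the elements v and w become divisible by x: with v1 = z - Q p and
   w1 = x u - 2 z p + Q p^2 one finds v = x v1, w = x w1 and p = v1^2 - Q w1.
   Write q = c + X a + Y b for the polynomial with Q = q(v, w), where c lies in
   C[x]; then Q = c + x r with r = v1 a(v, w) + w1 b(v, w).
   Put p0 = v1^2 - c w1 (so that p0 = p + x r w1) and s = v1 + c p0.  Then
   w1 + 2 v1 p0 + c p0^2 = x t with an explicit t, and p0 = s^2 - c x t, so s and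
   t determine p0, v1, w1, r, Q, and finally y, z, u: the quotient is the
   polynomial ring in s and t. *)

(** * Ring identities between the coordinates [s], [t] and [y], [z], [u] on the hypersurface
    [y = - (x * Q)] *)

Section RingIdentities.
Variable E : comPzRingType.
Implicit Types x q r Q s t y z u : E.

(* The prefix st_ (resp. yzu_) marks an element expressed through s and t (resp.
   y, z and u); q stands for the constant c of the decomposition of Q. *)
Definition st_p0 x q s t := s ^+ 2 - q * x * t.
Definition st_v1 x q s t := s - q * st_p0 x q s t.
Definition st_w1 x q s t :=
  x * t - 2%:R * st_v1 x q s t * st_p0 x q s t - q * st_p0 x q s t ^+ 2.
Definition st_y x Q := - (x * Q).
Definition st_p x q r s t := st_p0 x q s t - x * r * st_w1 x q s t.
Definition st_z x q Q r s t := st_v1 x q s t + Q * st_p x q r s t.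
(** For [Q = q + x * r] this is the quotient of w1 + 2 v1 p + Q p^2 by [x], written out so that
    nothing has to be divided. *)
Definition st_u x q Q r s t :=
  t - 2%:R * st_z x q Q r s t * r * st_w1 x q s t
  - x * Q * r ^+ 2 * st_w1 x q s t ^+ 2 + r * st_p0 x q s t ^+ 2.

Definition yzu_p y z u := y * u + z ^+ 2.
Definition yzu_v1 Q y z u := z - Q * yzu_p y z u.
Definition yzu_w1 x Q y z u :=
  x * u - 2%:R * z * yzu_p y z u + Q * yzu_p y z u ^+ 2.
Definition yzu_p0 x Q r y z u := yzu_p y z u + x * r * yzu_w1 x Q y z u.
Definition yzu_s x q Q r y z u := yzu_v1 Q y z u + q * yzu_p0 x Q r y z u.
(** The corrections of [st_u] with opposite signs: for [Q = q + x * r], [x] times this is w1 + 2 v1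
    p0 + q p0^2. *)
Definition yzu_t x Q r y z u :=
  u + 2%:R * z * r * yzu_w1 x Q y z u
  + x * Q * r ^+ 2 * yzu_w1 x Q y z u ^+ 2 - r * yzu_p0 x Q r y z u ^+ 2.

(** Replacing [z] by v1 + Q p leaves a multiple of [y + x * Q], which vanishes both modulo f and
    after substituting [st_y] for [y]. *)
Lemma yzu_vE x Q y z u :
  x * z + y * yzu_p y z u =
  x * yzu_v1 Q y z u + (y + x * Q) * yzu_p y z u.
Proof. rewrite /yzu_v1; ring. Qed.

Lemma yzu_wE x Q y z u :
  x ^+ 2 * u - 2%:R * x * z * yzu_p y z u - y * yzu_p y z u ^+ 2 =
  x * yzu_w1 x Q y z u - (y + x * Q) * yzu_p y z u ^+ 2.
Proof. rewrite /yzu_w1; ring. Qed.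

Section FromST.
Variables (x q r s t : E).
Let Q := q + x * r.
Let y := st_y x Q.
Let z := st_z x q Q r s t.
Let u := st_u x q Q r s t.

(** The formulas give p0 = v1^2 - q w1, so p = v1^2 - Q w1; adding Q x u = Q (w1 + 2 v1 p + Q p^2)
    yields (v1 + Q p)^2 = z^2. *)
Lemma yzu_p_st : yzu_p y z u = st_p x q r s t.
Proof.
rewrite /yzu_p /y /z /u /Q /st_u /st_z /st_y /st_p /st_w1 /st_v1 /st_p0; ring.
Qed.

Lemma yzu_v1_st : yzu_v1 Q y z u = st_v1 x q s t.
Proof. by rewrite /yzu_v1 yzu_p_st /z /st_z addrK. Qed.

Lemma yzu_w1_st : yzu_w1 x Q y z u = st_w1 x q s t.
Proof.
rewrite /yzu_w1 yzu_p_st.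
rewrite /y /z /u /Q /st_u /st_z /st_y /st_p /st_w1 /st_v1 /st_p0; ring.
Qed.

Lemma yzu_p0_st : yzu_p0 x Q r y z u = st_p0 x q s t.
Proof. by rewrite /yzu_p0 yzu_p_st yzu_w1_st subrK. Qed.

Lemma yzu_s_st : yzu_s x q Q r y z u = s.
Proof. by rewrite /yzu_s yzu_v1_st yzu_p0_st subrK. Qed.

Lemma yzu_t_st : yzu_t x Q r y z u = t.
Proof. rewrite /yzu_t yzu_w1_st yzu_p0_st /u /st_u -/z; ring. Qed.

End FromST.

Section FromYZU.
Variables (x q r y z u : E).
Let Q := q + x * r.
Hypothesis yE : y = - (x * Q).
Let s := yzu_s x q Q r y z u.
Let t := yzu_t x Q r y z u.

(** By [yE], p = z^2 - x Q u = v1^2 - Q w1, hence p0 = v1^2 - q w1; this is s^2 - q x t because x t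
    = w1 + 2 v1 p0 + q p0^2. *)
Lemma st_p0_yzu : st_p0 x q s t = yzu_p0 x Q r y z u.
Proof.
rewrite /st_p0 /s /t /yzu_t /yzu_s /yzu_p0 /yzu_w1 /yzu_v1 /yzu_p yE /Q; ring.
Qed.

Lemma st_v1_yzu : st_v1 x q s t = yzu_v1 Q y z u.
Proof. by rewrite /st_v1 st_p0_yzu addrK. Qed.

Lemma st_w1_yzu : st_w1 x q s t = yzu_w1 x Q y z u.
Proof.
rewrite /st_w1 st_v1_yzu st_p0_yzu.
rewrite /t /yzu_t /yzu_p0 /yzu_w1 /yzu_v1 /yzu_p /Q; ring.
Qed.

Lemma st_z_yzu : st_z x q Q r s t = z.
Proof. by rewrite /st_z /st_p st_v1_yzu st_w1_yzu st_p0_yzu addrK subrK. Qed.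

Lemma st_u_yzu : st_u x q Q r s t = u.
Proof.
rewrite /st_u st_z_yzu st_w1_yzu st_p0_yzu /t /yzu_t; ring.
Qed.

End FromYZU.
End RingIdentities.

(** * Compatibility of these formulas with ring morphisms *)

Section Morphism.
Variables (E F : comPzRingType) (phi : {rmorphism E -> F}).
Implicit Types x q r Q s t y z u : E.

Let morphE := (rmorphB, rmorphN, rmorphD, rmorphM, rmorphXn, rmorph1).

Lemma rmorph_dot2 s y t z :
  phi (s * y + t * z) = phi s * phi y + phi t * phi z.
Proof. by rewrite !morphE. Qed.

Lemma rmorph_st_v1 x q s t :
  phi (st_v1 x q s t) = st_v1 (phi x) (phi q) (phi s) (phi t).
Proof. by rewrite /st_v1 /st_p0 !morphE. Qed.

Lemma rmorph_st_w1 x q s t :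
  phi (st_w1 x q s t) = st_w1 (phi x) (phi q) (phi s) (phi t).
Proof. by rewrite /st_w1 /st_v1 /st_p0 !morphE. Qed.

Lemma rmorph_st_y x Q : phi (st_y x Q) = st_y (phi x) (phi Q).
Proof. by rewrite /st_y !morphE. Qed.

Lemma rmorph_st_z x q Q r s t :
  phi (st_z x q Q r s t) =
  st_z (phi x) (phi q) (phi Q) (phi r) (phi s) (phi t).
Proof. by rewrite /st_z /st_p /st_w1 /st_v1 /st_p0 !morphE. Qed.

Lemma rmorph_st_u x q Q r s t :
  phi (st_u x q Q r s t) =
  st_u (phi x) (phi q) (phi Q) (phi r) (phi s) (phi t).
Proof. by rewrite /st_u /st_z /st_p /st_w1 /st_v1 /st_p0 !morphE. Qed.

Lemma rmorph_yzu_p y z u : phi (yzu_p y z u) = yzu_p (phi y) (phi z) (phi u).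
Proof. by rewrite /yzu_p !morphE. Qed.

Lemma rmorph_yzu_v1 Q y z u :
  phi (yzu_v1 Q y z u) = yzu_v1 (phi Q) (phi y) (phi z) (phi u).
Proof. by rewrite /yzu_v1 /yzu_p !morphE. Qed.

Lemma rmorph_yzu_w1 x Q y z u :
  phi (yzu_w1 x Q y z u) = yzu_w1 (phi x) (phi Q) (phi y) (phi z) (phi u).
Proof. by rewrite /yzu_w1 /yzu_v1 /yzu_p !morphE. Qed.

Lemma rmorph_yzu_s x q Q r y z u :
  phi (yzu_s x q Q r y z u) =
  yzu_s (phi x) (phi q) (phi Q) (phi r) (phi y) (phi z) (phi u).
Proof. by rewrite /yzu_s /yzu_p0 /yzu_w1 /yzu_v1 /yzu_p !morphE. Qed.

Lemma rmorph_yzu_t x Q r y z u :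
  phi (yzu_t x Q r y z u) =
  yzu_t (phi x) (phi Q) (phi r) (phi y) (phi z) (phi u).
Proof. by rewrite /yzu_t /yzu_s /yzu_p0 /yzu_w1 /yzu_v1 /yzu_p !morphE. Qed.

End Morphism.

(** * The quotient map as a ring morphism *)

Section PquotMorphism.
Variables (A : comNzRingType) (B : comAlgType A) (f : B).

HB.instance Definition _ :=
  GRing.isZmodMorphism.Build B (pquot f) (@pquot_pi A B f)
  (raddfB (\pi_(Quotient.quot (principal f))%qT)).
HB.instance Definition _ :=
  GRing.isMonoidMorphism.Build B (pquot f) (@pquot_pi A B f)
  (conj erefl (@pquot_piM A B f)).

End PquotMorphism.

(** * Substitution in polynomials and a criterion for hyperplanes *)

Lemma dot2_congr (E : pzRingType) (s y t z s' y' t' z' : E) :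
  s = s' -> y = y' -> t = t' -> z = z' -> s * y + t * z = s' * y' + t' * z'.
Proof. by move=> -> -> -> ->. Qed.

Lemma ord2P (P : 'I_2 -> Prop) : P ord0 -> P ord_max -> forall i, P i.
Proof.
move=> P0 P1 [[|[|//]] i_lt].
  by rewrite (_ : Ordinal _ = ord0) //; apply: val_inj.
by rewrite (_ : Ordinal _ = ord_max) //; apply: val_inj.
Qed.

Lemma ord3P (P : 'I_3 -> Prop) :
  P (@Ordinal 3 0 isT) -> P (@Ordinal 3 1 isT) -> P (@Ordinal 3 2 isT) ->
  forall i, P i.
Proof.
by move=> P0 P1 P2 [[|[|[|//]]] i_lt];
  rewrite (bool_irrelevance i_lt isT).
Qed.

Lemma comp_mpolyA (A : comNzRingType) (l m n : nat) (p : {mpoly A[l]})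
    (s : l.-tuple {mpoly A[m]}) (t : m.-tuple {mpoly A[n]}) :
  p \mPo s \mPo t = p \mPo [tuple tnth s i \mPo t | i < l].
Proof.
rewrite [p \mPo s]comp_mpolyE [RHS]comp_mpolyE raddf_sum /=.
apply: eq_bigr => m' _; rewrite linearZ rmorph_prod /=; congr (_ *: _).
by apply: eq_bigr => i _; rewrite rmorphXn tnth_mktuple.
Qed.

Lemma comp_mpoly_pquot (A : comNzRingType) (m n : nat) (f : {mpoly A[n]})
    (s t : m.-tuple {mpoly A[n]}) (p : {mpoly A[m]}) :
  (forall i, pquot_pi f (tnth s i) = pquot_pi f (tnth t i)) ->
  pquot_pi f (p \mPo s) = pquot_pi f (p \mPo t).
Proof.
move=> st; rewrite !comp_mpolyE !raddf_sum; apply: eq_bigr => m' _.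
rewrite /= !pquot_piZ !rmorph_prod; congr pquot_scale.
by apply: eq_bigr => i _; rewrite !rmorphXn /= st.
Qed.

(** Since [f] vanishes at [g], substituting [g] factors through the quotient. Substituting [h] and
    taking the class is the inverse, which has to be checked on the variables only. *)
Lemma hyperplane_retract (A : comNzRingType) (n : nat) (f : {mpoly A[n.+1]})
    (g : n.+1.-tuple {mpoly A[n]}) (h : n.-tuple {mpoly A[n.+1]}) :
  f \mPo g = 0 ->
  (forall i, tnth h i \mPo g = 'X_i) ->
  (forall i, pquot_pi f (tnth g i \mPo h) = pquot_pi f 'X_i) ->
  hyperplane f.
Proof.
move=> fg0 hgK ghK.
(* Two representatives differ by a multiple of [f], which [g] kills. *)
have phiP (b : {mpoly A[n.+1]}) : repr (pquot_pi f b) \mPo g = b \mPo g.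
  apply/eqP; rewrite -subr_eq0 -raddfB /=.
  by have /principalP[c ->] := repr_pquot_pi f b; rewrite rmorphM /= fg0 mulr0.
exists (fun c => repr c \mPo g); split.
- move=> a c d; rewrite -[c]pquot_piK -[d]pquot_piK.
  by rewrite -[a *: _]pquot_piZ -pquot_piD !phiP linearP.
- split=> [|c d]; first by rewrite [repr _ \mPo g](phiP 1) rmorph1.
  by rewrite -[c]pquot_piK -[d]pquot_piK -rmorphM !phiP rmorphM.
exists (fun b => pquot_pi f (b \mPo h)) => [c|b].
  rewrite comp_mpolyA -[RHS]pquot_piK -[X in _ = pquot_pi f X]comp_mpoly_id.
  by apply: comp_mpoly_pquot => i; rewrite !tnth_mktuple.
rewrite phiP comp_mpolyA -[RHS]comp_mpoly_id; congr (_ \mPo _).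
by apply: eq_from_tnth => i; rewrite !tnth_mktuple.
Qed.

(** Monomial by monomial: those divisible by the first variable go to [a], the pure positive powers
    of the second to [b], the monomial 1 to [c]. *)
Lemma mpoly2_decomp (A : comNzRingType) (q : {mpoly A[2]}) :
  exists c (a b : {mpoly A[2]}), q = c%:MP + 'X_ord0 * a + 'X_ord_max * b.
Proof.
elim/mpolyind: q => [|c m q _ _ [c' [a' [b' ->]]]].
  by exists 0, 0, 0; rewrite !mulr0 !addr0 mpolyC0.
suff [d [a [b ->]]] : exists d (a b : {mpoly A[2]}),
    'X_[m] = d%:MP + 'X_ord0 * a + 'X_ord_max * b.
  exists (c * d + c'), (c *: a + a'), (c *: b + b').
  rewrite !scalerDr !mulrDr mpolyCD mpolyCM mul_mpolyC !scalerAr; ring.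
rewrite mpolyXE_id !big_ord_recl big_ord0 mulr1.
case: (m ord0) => [|i]; last first.
  exists 0, ('X_ord0 ^+ i * 'X_(lift ord0 ord0) ^+ m (lift ord0 ord0)), 0.
  by rewrite mpolyC0 add0r mulr0 addr0 exprS mulrA.
have -> : lift ord0 ord0 = ord_max :> 'I_2 by apply: val_inj.
case: (m ord_max) => [|j]; first by exists 1, 0, 0; rewrite mpolyC1; ring.
exists 0, 0, ('X_ord_max ^+ j).
by rewrite mpolyC0 mulr0 !add0r expr0 mul1r exprS.
Qed.

Lemma comp_mpolyA2 (A : comNzRingType) (m n : nat) (p : {mpoly A[2]})
    (s t : {mpoly A[m]}) (h : m.-tuple {mpoly A[n]}) :
  p \mPo [tuple s; t] \mPo h = p \mPo [tuple s \mPo h; t \mPo h].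
Proof.
rewrite comp_mpolyA; congr (_ \mPo _); apply: eq_from_tnth.
by apply: ord2P; rewrite tnth_mktuple.
Qed.

Lemma comp_mpoly2_pquot (A : comNzRingType) (n : nat) (f : {mpoly A[n]})
    (s s' t t' : {mpoly A[n]}) (p : {mpoly A[2]}) :
  pquot_pi f s = pquot_pi f s' -> pquot_pi f t = pquot_pi f t' ->
  pquot_pi f (p \mPo [tuple s; t]) = pquot_pi f (p \mPo [tuple s'; t']).
Proof. by move=> ss' tt'; apply: comp_mpoly_pquot; apply: ord2P. Qed.

(** * The mutually inverse substitutions [g] and [h] *)

Section VenereauHyperplane.
Variables (k : comNzRingType) (c : {poly k}) (a b q : {mpoly {poly k}[2]}).
Local Notation A := {poly k}.
Hypothesis qE : q = c%:MP + 'X_ord0 * a + 'X_ord_max * b.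

Local Notation x2 := (('X : A)%:MP_[2]).
Local Notation c2 := (c%:MP_[2]).
Local Notation s2 := ('X_ord0 : {mpoly A[2]}).
Local Notation t2 := ('X_ord_max : {mpoly A[2]}).
(* Suffix 2 marks elements of A[s, t], suffix 3 elements of A[y, z, u].  They
   are given by equations rather than by definitions: unification would diverge
   if it could unfold them. *)
Variables v2 w2 r2 Q2 : {mpoly A[2]}.
Hypothesis v2E : v2 = st_v1 x2 c2 s2 t2.
Hypothesis w2E : w2 = st_w1 x2 c2 s2 t2.
(** The prospective images of v and w under [g]. They involve only [c], [s2], [t2], so [r2] and then
    [Q2] can be formed without circularity. *)
Variable xvw2 : 2.-tuple {mpoly A[2]}.
Hypothesis xvw2E : xvw2 = [tuple x2 * v2; x2 * w2].
Hypothesis r2E : r2 = v2 * (a \mPo xvw2) + w2 * (b \mPo xvw2).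
Hypothesis Q2E : Q2 = c2 + x2 * r2.

Local Notation x := (ven_x k).
Local Notation y := (ven_y k).
Local Notation z := (ven_z k).
Local Notation u := (ven_u k).
Local Notation c3 := (c%:MP_[3]).
Variable vw : 2.-tuple {mpoly A[3]}.
Hypothesis vwE : vw = [tuple ven_v k; ven_w k].
Variables Q f v3 w3 r s3 t3 : {mpoly A[3]}.
Hypothesis QE : Q = q \mPo vw.
Hypothesis fE : f = y + x * Q.
Hypothesis v3E : v3 = yzu_v1 Q y z u.
Hypothesis w3E : w3 = yzu_w1 x Q y z u.
Hypothesis rE : r = v3 * (a \mPo vw) + w3 * (b \mPo vw).
Hypothesis s3E : s3 = yzu_s x c3 Q r y z u.
Hypothesis t3E : t3 = yzu_t x Q r y z u.

Variables (g : 3.-tuple {mpoly A[2]}) (h : 2.-tuple {mpoly A[3]}).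
Hypothesis gE : g =
  [tuple st_y x2 Q2; st_z x2 c2 Q2 r2 s2 t2; st_u x2 c2 Q2 r2 s2 t2].
Hypothesis hE : h = [tuple s3; t3].

Let q_comp n (s : 2.-tuple {mpoly A[n]}) :
  q \mPo s = c%:MP + (tnth s ord0 * (a \mPo s) + tnth s ord_max * (b \mPo s)).
Proof.
by rewrite qE !rmorphD !rmorphM /= comp_mpolyC !comp_mpolyXU -!tnth_nth addrA.
Qed.

(** * Images under [g] *)

Let yg : y \mPo g = st_y x2 Q2. Proof. rewrite gE; exact: comp_mpolyXU. Qed.
Let zg : z \mPo g = st_z x2 c2 Q2 r2 s2 t2.
Proof. rewrite gE; exact: comp_mpolyXU. Qed.
Let ug : u \mPo g = st_u x2 c2 Q2 r2 s2 t2.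
Proof. rewrite gE; exact: comp_mpolyXU. Qed.
Let xg : x \mPo g = x2. Proof. exact: comp_mpolyC. Qed.
Let yzug := (yg, zg, ug, xg).

Let vg : ven_v k \mPo g = x2 * v2.
Proof.
rewrite /ven_v /ven_p -/(yzu_p y z u) rmorphD !rmorphM rmorph_yzu_p /= !yzug.
(* The identity is taken at [Q2], as the image of [Q] is not known yet; its remainder vanishes
   because [y] goes to [- (x2 * Q2)]. *)
by rewrite (yzu_vE _ Q2) v2E Q2E yzu_v1_st /st_y addNr mul0r addr0.
Qed.

Let wg : ven_w k \mPo g = x2 * w2.
Proof.
rewrite /ven_w /ven_p -/(yzu_p y z u) !(rmorphB, rmorphXn, rmorphM).
rewrite rmorph_yzu_p rmorph_nat /= !yzug.
by rewrite (yzu_wE _ Q2) w2E Q2E yzu_w1_st /st_y addNr mul0r subr0.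
Qed.

Let vwg (p : {mpoly A[2]}) : p \mPo vw \mPo g = p \mPo xvw2.
Proof. by rewrite vwE comp_mpolyA2 vg wg xvw2E. Qed.

(** Closes the circle: v and w go to [x2 * v2] and [x2 * w2], so the nonconstant part of [q]
    acquires the factor [x2] and leaves [r2]. *)
Let Qg : Q \mPo g = Q2.
Proof.
by rewrite QE vwg q_comp Q2E r2E [in LHS]xvw2E -!mulrA -mulrDr -xvw2E.
Qed.

Let v3g : v3 \mPo g = v2.
Proof. by rewrite v3E v2E rmorph_yzu_v1 /= Qg !yzug Q2E yzu_v1_st. Qed.

Let w3g : w3 \mPo g = w2.
Proof. by rewrite w3E w2E rmorph_yzu_w1 /= Qg !yzug Q2E yzu_w1_st. Qed.

Let rg : r \mPo g = r2.
Proof. by rewrite rE r2E rmorph_dot2 /= v3g w3g !vwg. Qed.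

Let fg : f \mPo g = 0.
Proof. by rewrite fE rmorphD rmorphM /= Qg !yzug /st_y addNr. Qed.

Let sg : s3 \mPo g = s2.
Proof.
by rewrite s3E rmorph_yzu_s /= Qg rg !yzug comp_mpolyC Q2E yzu_s_st.
Qed.

Let tg : t3 \mPo g = t2.
Proof. by rewrite t3E rmorph_yzu_t /= Qg rg !yzug Q2E yzu_t_st. Qed.

(** * Computation modulo [f] *)

Local Notation pi := (pquot_pi f).

Let f0 : pi f = 0.
Proof.
rewrite -(rmorph0 pi); apply/pquot_piP/principalP.
by exists 1; rewrite mul1r subr0.
Qed.

Let pi_v : pi (ven_v k) = pi x * pi v3.
Proof.
have -> : ven_v k = x * v3 + f * yzu_p y z u by rewrite v3E fE -yzu_vE.
by rewrite rmorphD !rmorphM /= f0 mul0r addr0.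
Qed.

Let pi_w : pi (ven_w k) = pi x * pi w3.
Proof.
have -> : ven_w k = x * w3 - f * yzu_p y z u ^+ 2 by rewrite w3E fE -yzu_wE.
by rewrite rmorphB !rmorphM /= f0 mul0r subr0.
Qed.

Let pi_Q : pi Q = pi c3 + pi x * pi r.
Proof.
rewrite QE q_comp rE rmorphD !rmorph_dot2 /= {1 3}vwE pi_v pi_w.
by rewrite -!mulrA -mulrDr.
Qed.

(** The relation f = 0, in the shape of the hypothesis [yE]: it makes the identities of [FromYZU]
    available in the ring [pquot f]. *)
Let pi_y : pi y = - (pi x * (pi c3 + pi x * pi r)).
Proof.
by apply/eqP; rewrite -pi_Q -addr_eq0 -rmorphM -rmorphD /= -fE; apply/eqP.
Qed.

Let pi_s3 :
  pi s3 =
  yzu_s (pi x) (pi c3) (pi c3 + pi x * pi r) (pi r) (pi y) (pi z) (pi u).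
Proof. by rewrite -pi_Q s3E rmorph_yzu_s. Qed.

Let pi_t3 :
  pi t3 = yzu_t (pi x) (pi c3 + pi x * pi r) (pi r) (pi y) (pi z) (pi u).
Proof. by rewrite -pi_Q t3E rmorph_yzu_t. Qed.

Let xh : x2 \mPo h = x. Proof. exact: comp_mpolyC. Qed.
Let ch : c2 \mPo h = c3. Proof. exact: comp_mpolyC. Qed.
Let sh : s2 \mPo h = s3. Proof. rewrite hE; exact: comp_mpolyXU. Qed.
Let th : t2 \mPo h = t3. Proof. rewrite hE; exact: comp_mpolyXU. Qed.
Let sth := (xh, ch, sh, th).

Let pi_v2h : pi (v2 \mPo h) = pi v3.
Proof.
rewrite v2E v3E rmorph_st_v1 /= !sth rmorph_st_v1 rmorph_yzu_v1 /=.
rewrite pi_s3 pi_t3 pi_Q; exact: st_v1_yzu pi_y.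
Qed.

Let pi_w2h : pi (w2 \mPo h) = pi w3.
Proof.
rewrite w2E w3E rmorph_st_w1 /= !sth rmorph_st_w1 rmorph_yzu_w1 /=.
rewrite pi_s3 pi_t3 pi_Q; exact: st_w1_yzu pi_y.
Qed.

(** Modulo [f], [h] takes [x2 * v2] and [x2 * w2] back to v and w; applied to [a] and [b], this
    recovers [r] and then [Q]. *)
Let pi_xvw2h (p : {mpoly A[2]}) : pi (p \mPo xvw2 \mPo h) = pi (p \mPo vw).
Proof.
rewrite xvw2E vwE comp_mpolyA2; apply: comp_mpoly2_pquot.
  by rewrite pi_v !rmorphM /= xh pi_v2h.
by rewrite pi_w !rmorphM /= xh pi_w2h.
Qed.

Let pi_r2h : pi (r2 \mPo h) = pi r.
Proof.
rewrite r2E rE [X in pi X = _]rmorph_dot2 [LHS]rmorph_dot2 [RHS]rmorph_dot2 /=.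
apply: dot2_congr.
- exact: pi_v2h.
- exact: pi_xvw2h.
- exact: pi_w2h.
- exact: pi_xvw2h.
Qed.

Let pi_Q2h : pi (Q2 \mPo h) = pi Q.
Proof.
by rewrite pi_Q Q2E rmorphD rmorphM /= xh ch rmorphD rmorphM /= pi_r2h.
Qed.

Lemma venereau_hyperplane : hyperplane f.
Proof.
apply: (@hyperplane_retract _ _ f g h fg).
  by rewrite hE; apply: ord2P; [exact: sg | exact: tg].
rewrite gE; apply: ord3P; rewrite [tnth _ _]/=.
- by rewrite !rmorph_st_y /= xh pi_Q2h /st_y pi_Q -pi_y.
- rewrite !rmorph_st_z /= !sth pi_Q2h pi_r2h pi_s3 pi_t3 pi_Q.
  exact: st_z_yzu pi_y.
- rewrite !rmorph_st_u /= !sth pi_Q2h pi_r2h pi_s3 pi_t3 pi_Q.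
  exact: st_u_yzu pi_y.
Qed.

End VenereauHyperplane.

Theorem theorem20 (R : realType) (Q : {mpoly {poly R[i]}[3]})
    (hQ : in_subalg [tuple ven_v R[i]; ven_w R[i]] Q) :
  hyperplane (ven_y R[i] + ven_x R[i] * Q).
Proof.
have [q ->] := hQ; have [c [a [b qE]]] := mpoly2_decomp q.
(* Each [erefl] instantiates an element that was fixed by an equation with the right-hand side of
   that equation. *)
exact: (venereau_hyperplane qE erefl erefl erefl erefl erefl erefl erefl erefl
          erefl erefl erefl erefl erefl erefl erefl).
Qed.
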